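(* Let $A\in\mathbb{R}^{n\times n}$ be such that the set $\Lambda_1$ of rightmost eigenvalues of $A$ is single complex, and use the Euclidean norm as vector norm. Let $y_0\in\mathbb{R}^n$ with $w^{(1)}y_0\ne0$ and put $\widehat y_0:=y_0/\|y_0\|_2$. Then $$\max_{t\in\mathbb{R}}\mathrm{OT}(t,y_0)=G^{\max}_{V_1W_1}\big(\gamma_1(\widehat y_0)-\theta_1\big)\quad\text{and}\quad \min_{t\in\mathbb{R}}\mathrm{OT}(t,y_0)=G^{\min}_{V_1W_1}\big(\gamma_1(\widehat y_0)-\theta_1\big).$$
   Context: The spectrum of $A$ is partitioned by real parts into $\Lambda_1,\dots,\Lambda_q$ with $\Lambda_1$ the set of eigenvalues of largest real part. $\Lambda_1$ is single complex if it consists of a complex conjugate pair $\lambda_1,\overline{\lambda_1}$ of non-real eigenvalues, each having exactly one Jordan block of maximum order; $\lambda_1$ is the one with positive imaginary part $\omega_1>0$. Let $V$ be an invertible matrix whose columns form a Jordan basis for $A$ and $W=V^{-1}$. Let $v^{(1,1)},\dots,v^{(1,M_1)}$ (columns of $V$) be the unique longest Jordan chain for $\lambda_1$, with $v^{(1,1)}$ an eigenvector; put $v^{(1)}:=v^{(1,1)}$ and let $w^{(1)}$ be the row of $W$ whose index equals the column index of $v^{(1,M_1)}$ in $V$. The basis is chosen so that $\overline{v^{(1,1)}},\dots,\overline{v^{(1,M_1)}}$ are columns of $V$ forming the longest Jordan chain for $\overline{\lambda_1}$ and the row of $W$ corresponding to $\overline{v^{(1,M_1)}}$ is $\overline{w^{(1)}}$.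 Put $\widehat v^{(1)}:=v^{(1)}/\|v^{(1)}\|_2$ and $\widehat w^{(1)}:=w^{(1)}/\|w^{(1)}\|_2$. $V_1:=|(\widehat v^{(1)})^T\widehat v^{(1)}|$ and $W_1:=|\widehat w^{(1)}(\widehat w^{(1)})^T|$ (transposes without conjugation); one has $V_1,W_1\in[0,1)$. For $u\in\mathbb{R}^n$ with $\widehat w^{(1)}u\neq0$, $\gamma_1(u)$ is the angle in the polar form of $\widehat w^{(1)}u$. Let $R_1\in\mathbb{R}^{2\times n}$ be the matrix with rows $\mathrm{Re}(\widehat w^{(1)})$ and $\mathrm{Im}(\widehat w^{(1)})$, $\sigma_1\ge\mu_1$ its singular values and $\alpha^{(1)}\in\mathbb{R}^2$ a unit left singular vector corresponding to $\sigma_1$; identifying $\mathbb{R}^2$ with $\mathbb{C}$, $\theta_1$ is the angle between the real axis and $\alpha^{(1)}$ (the direction of the major semi-axis $\sigma_1\alpha^{(1)}$ of the ellipse with semi-axes given by the singular values and left singular vectors of $R_1$). Writing $\widehat v^{(1)}_k=|\widehat v^{(1)}_k|\mathrm{e}^{\mathrm{i}\alpha_{1k}}$ and $\widehat w^{(1)}_l=|\widehat w^{(1)}_l|\mathrm{e}^{\mathrm{i}\beta_{1l}}$, put $$\widehat\Theta_1(t,u):=\big(|\widehat v^{(1)}_k|\cos(\omega_1t+\alpha_{1k}+\gamma_1(u))\big)_{k}\in\mathbb{R}^n,\quad \widehat\Theta_1(t):=\big[|\widehat v^{(1)}_k||\widehat w^{(1)}_l|\cos(\omega_1t+\alpha_{1k}+\beta_{1l})\big]_{k,l}\in\mathbb{R}^{n\times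 n}.$$ The oscillating term is $\mathrm{OT}(t,y_0):=\|\widehat\Theta_1(t)\|_2/\|\widehat\Theta_1(t,\widehat y_0)\|_2$, with the spectral norm in the numerator. For numbers $V,W\in[0,1)$: $f_{VW}(\alpha,x):=\dfrac{1+V\cos(x+\alpha)}{1-W\cos\alpha}$, $f^{\max}_{VW}(x):=\max_{\alpha\in\mathbb{R}}f_{VW}(\alpha,x)$, $H_{VW}(x,\beta):=\dfrac{f^{\max}_{VW}(x)}{1+V\cos(x+\beta)}$, $H^{\max}_{VW}(\beta):=\max_{x\in\mathbb{R}}H_{VW}(x,\beta)$, $H^{\min}_{VW}(\beta):=\min_{x\in\mathbb{R}}H_{VW}(x,\beta)$. Then $G^{\max}_{V_1W_1}(\gamma):=\sqrt{\frac{1-W_1^2}{2}H^{\max}_{V_1W_1}(2\gamma)}$ and $G^{\min}_{V_1W_1}(\gamma):=\sqrt{\frac{1-W_1^2}{2}H^{\min}_{V_1W_1}(2\gamma)}$, $\gamma\in\mathbb{R}$. *)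

(* Defs.v *)
From mathcomp Require Export all_boot all_order all_algebra.
From mathcomp Require Export boolp classical_sets reals topology normedtype.
From mathcomp Require Export trigo.
From mathcomp Require Export complex.

Set Implicit Arguments.
Unset Strict Implicit.
Unset Printing Implicit Defensive.

Import Order.TTheory GRing.Theory Num.Theory ComplexField.

Local Open Scope classical_set_scope.
Local Open Scope ring_scope.
Local Open Scope complex_scope.

Definition is_max (R : realType) (E : set R) (m : R) : Prop :=
  E m /\ ubound E m.

Definition is_min (R : realType) (E : set R) (m : R) : Prop :=
  E m /\ lbound E m.

(* The default value 0 is only taken when the extremum is not attained. *)
Definition maxval (R : realType) (E : set R) : R := xget 0 (is_max E).

Definition minval (R : realType) (E : set R) : R := xget 0 (is_min E).

Section Norms.
Variable R : realType.

Definition norm2 n (x : 'cV[R]_n) : R := Num.sqrt (\sum_i x i 0 ^+ 2).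

Definition spectral_norm m n (M : 'M[R]_(m, n)) : R :=
  sup [set norm2 (M *m x) | x in [set x | norm2 x = 1]].

(* Euclidean norm of a complex column or row vector (m or n is 1). *)
Definition cnorm2 m n (z : 'M[R[i]]_(m, n)) : R :=
  Num.sqrt (\sum_i \sum_j Normc.normc (z i j) ^+ 2).

Definition normalize n (x : 'cV[R]_n) : 'cV[R]_n := (norm2 x)^-1 *: x.

Definition cnormalize m n (z : 'M[R[i]]_(m, n)) : 'M[R[i]]_(m, n) :=
  ((cnorm2 z)^-1)%:C *: z.

Definition cmx m n (M : 'M[R]_(m, n)) : 'M[R[i]]_(m, n) :=
  map_mx (real_complex R) M.

(* a is an angle in a polar form of z; it is determined modulo 2 pi when
   z != 0, and arbitrary when z = 0. *)
Definition polar_angle (z : R[i]) (a : R) : Prop :=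
  z = (Normc.normc z * cos a) +i* (Normc.normc z * sin a).

Definition singular_triple m n (M : 'M[R]_(m, n))
    (s : R) (a : 'cV[R]_m) (b : 'cV[R]_n) : Prop :=
  [/\ 0 <= s, norm2 a = 1, norm2 b = 1,
      M *m b = s *: a & M^T *m a = s *: b].

Definition singular_value m n (M : 'M[R]_(m, n)) (s : R) : Prop :=
  exists a b, singular_triple M s a b.

Definition largest_singular_value m n (M : 'M[R]_(m, n)) (s : R) : Prop :=
  is_max (singular_value M) s.

Definition left_singular_vector m n (M : 'M[R]_(m, n))
    (s : R) (a : 'cV[R]_m) : Prop :=
  exists b, singular_triple M s a b.

End Norms.

Section Spectrum.
Variables (R : realType) (n : nat) (A : 'M[R]_n).
Implicit Types (V : 'M[R[i]]_n) (mu : R[i]) (c : seq 'I_n).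

Definition rightmost : set R[i] :=
  [set mu | eigenvalue (cmx A) mu /\
     forall nu, eigenvalue (cmx A) nu -> complex.Re nu <= complex.Re mu].

(* A chain is the list of the indices of its columns in V, eigenvector first. *)
Definition jordan_chain V mu c : bool :=
  if c is j :: s then
    (cmx A *m col j V == mu *: col j V) &&
    path (fun i k => cmx A *m col k V == mu *: col k V + col i V) j s
  else false.

(* The chains partition the columns of V, in an arbitrary order. *)
Definition jordan_basis V (chains : seq (seq 'I_n)) : Prop :=
  [/\ V \in unitmx, perm_eq (flatten chains) (enum 'I_n) &
      forall c, c \in chains -> exists mu, jordan_chain V mu c].

Definition longest_chain V (chains : seq (seq 'I_n)) mu c : Prop :=
  [/\ c \in chains, jordan_chain V mu c &
      forall c', c' \in chains -> jordan_chain V mu c' ->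
        (size c' <= size c)%N].

(* The Jordan blocks of mu are read off a Jordan basis; their number and their
   orders do not depend on which one. *)
Definition one_block_of_max_order mu : Prop :=
  exists V chains, jordan_basis V chains /\
    exists! c, longest_chain V chains mu c.

Definition single_complex : Prop :=
  exists lam : R[i],
    [/\ complex.Im lam != 0, rightmost = [set lam; lam^*] &
        forall mu, rightmost mu -> one_block_of_max_order mu].

(* The conjugates of the columns of the chain j :: s for lam are, in order, the
   columns of a longest chain for the conjugate of lam, and the rows of V^-1
   matching the last vectors of the two chains are conjugate as well. *)
Definition conjugate_chain V (chains : seq (seq 'I_n)) (lam : R[i])
    (j : 'I_n) (s : seq 'I_n) : Prop :=
  exists (j' : 'I_n) (s' : seq 'I_n),
    [/\ longest_chain V chains lam^* (j' :: s'),
        [seq col k V | k <- j' :: s']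
          = [seq map_mx conjc (col k V) | k <- j :: s] &
        row (last j' s') (invmx V)
          = map_mx conjc (row (last j s) (invmx V))].

End Spectrum.

Section Oscillation.
Variable R : realType.

Definition re_im_rows n (w : 'rV[R[i]]_n) : 'M[R]_(2, n) :=
  \matrix_(i < 2, l < n)
    if i == 0 then complex.Re (w 0 l) else complex.Im (w 0 l).

Definition Theta_vec n (v : 'cV[R[i]]_n) (alpha : 'I_n -> R)
    (omega gamma t : R) : 'cV[R]_n :=
  \col_k (Normc.normc (v k 0) * cos (omega * t + alpha k + gamma)).

Definition Theta_mx n (v : 'cV[R[i]]_n) (w : 'rV[R[i]]_n)
    (alpha beta : 'I_n -> R) (omega t : R) : 'M[R]_n :=
  \matrix_(k, l) (Normc.normc (v k 0) * Normc.normc (w 0 l)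
                  * cos (omega * t + alpha k + beta l)).

(* gamma is the angle of w u, where u is the normalized initial value *)
Definition OT n (v : 'cV[R[i]]_n) (w : 'rV[R[i]]_n)
    (alpha beta : 'I_n -> R) (omega gamma t : R) : R :=
  spectral_norm (Theta_mx v w alpha beta omega t)
  / norm2 (Theta_vec v alpha omega gamma t).

Definition fVW (V W alpha x : R) : R :=
  (1 + V * cos (x + alpha)) / (1 - W * cos alpha).

Definition fmax (V W x : R) : R := maxval (range (fun alpha => fVW V W alpha x)).

Definition HVW (V W x beta : R) : R := fmax V W x / (1 + V * cos (x + beta)).

Definition Hmax (V W beta : R) : R := maxval (range (fun x => HVW V W x beta)).

Definition Hmin (V W beta : R) : R := minval (range (fun x => HVW V W x beta)).

Definition Gmax (V W gamma : R) : R :=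
  Num.sqrt ((1 - W ^+ 2) / 2 * Hmax V W (2 * gamma)).

Definition Gmin (V W gamma : R) : R :=
  Num.sqrt ((1 - W ^+ 2) / 2 * Hmin V W (2 * gamma)).

End Oscillation.

(* Main.v *)
Require Import Defs.
From mathcomp Require Import ring lra.
From mathcomp Require Import realfun derive.
Set Implicit Arguments.
Unset Strict Implicit.
Unset Printing Implicit Defensive.
Import Order.TTheory GRing.Theory Num.Theory ComplexField.
Import numFieldNormedType.Exports.
Local Open Scope classical_set_scope.
Local Open Scope ring_scope.
Local Open Scope complex_scope.

(* For a real unit vector u write w u = r e^(i phi). The squared norm of
   Theta(t) u is r^2 (1 + V1 cos(x + 2 (phi - theta))) / 2 with an angle x that
   is affine in t, and Theta(t, u) is the case r = 1. As u runs over the unit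
   sphere, the largest r possible in the direction phi is given by the ellipse
   with semi-axes the singular values of (Re w; Im w):
   r^2 = (1 - W1^2) / 2 / (1 - W1 cos(2 (phi - theta))), because
   w w^T = W1 e^(2 i theta) and hence the squared semi-axes are (1 +- W1) / 2.
   So the squared spectral norm is (1 - W1^2) / 4 times the maximum of fVW(., x),
   and OT(t)^2 = (1 - W1^2) / 2 * HVW(x, 2 (gamma - theta)).
   That maximum has a closed form, which makes HVW continuous and periodic in x,
   so its extrema are attained. Finally V1, W1 < 1 because otherwise v (resp. w)
   would be proportional to its conjugate, whereas the two are eigenvectors for
   distinct eigenvalues (resp. distinct rows of the inverse of V). *)

(** * Attained extrema and the values chosen for them *)

Section Extrema.
Variable R : realType.
Implicit Types (E : set R) (m : R).

Lemma is_max_maxval E m : is_max E m -> maxval E = m.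
Proof.
move=> [Em ubm]; apply/xget_unique => // m' [Em' ubm'].
by apply/eqP; rewrite eq_le ubm // ubm'.
Qed.

Lemma is_min_minval E m : is_min E m -> minval E = m.
Proof.
move=> [Em lbm]; apply/xget_unique => // m' [Em' lbm'].
by apply/eqP; rewrite eq_le lbm // lbm'.
Qed.

Lemma is_max_sup E m : is_max E m -> sup E = m.
Proof.
move=> [Em ubm]; apply/eqP; rewrite eq_le ge_sup //; last by exists m.
by apply: ub_le_sup => //; exists m.
Qed.

End Extrema.

(** * Closed form of [fmax] and attained extrema of [HVW] *)

Section Trigonometry.
Variable R : realType.
Implicit Types (r x y t b V W : R).

Lemma cos2x t : cos (2 * t) = cos t ^+ 2 - sin t ^+ 2.
Proof. by rewrite mulr_natl mulr2n cosD -!expr2. Qed.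

Lemma sin2x t : sin (2 * t) = 2 * cos t * sin t.
Proof. by rewrite mulr_natl mulr2n sinD; ring. Qed.

(** [acos] gives the angle up to sign and the sign of [y] decides. Amplitudes that may vanish
    require the case [r = 0]; the bounds on [t] serve the reduction to a compact interval. *)
Lemma exists_angle x y r : 0 <= r -> x ^+ 2 + y ^+ 2 = r ^+ 2 ->
  exists t, [/\ - pi <= t <= pi, x = r * cos t & y = r * sin t].
Proof.
move=> r0 xyr; have pi0 := pi_ge0 R.
have [r_eq0|rN0] := eqVneq r 0.
  exists 0; rewrite r_eq0 !mul0r oppr_le0 pi0; split=> //; nra.
have r_gt0 : 0 < r by rewrite lt_def rN0.
have c1 : -1 <= x / r <= 1.
  by rewrite -ler_norml normrM normfV ler_pdivrMr ?normr_gt0 // mul1r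
     -ler_sqr ?nnegrE // !real_normK ?num_real //; nra.
have xE : x = r * cos (acos (x / r)).
  by rewrite acosK ?in_itv //= mulrCA divff ?mulr1.
have yE : y ^+ 2 = (r * sin (acos (x / r))) ^+ 2.
  have := cos2Dsin2 (acos (x / r)); nra.
have a0 := acos_ge0 c1; have api := acos_lepi c1.
move/eqP: yE; rewrite eqf_sqr => /orP[/eqP yE|/eqP yE].
  by exists (acos (x / r)); split=> //; lra.
exists (- acos (x / r)); rewrite cosN sinN mulrN; split=> //; lra.
Qed.

Lemma exists_angle_period t :
  exists2 s, s \in `[- pi, pi] & cos t = cos s /\ sin t = sin s.
Proof.
have [|s [si ct st]] := @exists_angle (cos t) (sin t) 1 ler01.
  by rewrite cos2Dsin2 expr1n.
by exists s; rewrite ?in_itv // ct st !mul1r.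
Qed.

(** By Lagrange's identity, [r ^+ 2] exceeds the square of the left-hand side by
    [(x * sin t + y * cos t) ^+ 2]. *)
Lemma cos_sin_cauchy x y r t : 0 <= r -> x ^+ 2 + y ^+ 2 = r ^+ 2 ->
  x * cos t - y * sin t <= r.
Proof.
move=> r0 xyr; have := cos2Dsin2 t; set c := cos t; set s := sin t => cs.
have : (x * c - y * s) ^+ 2 <= r ^+ 2.
  have -> : r ^+ 2 = (x * c - y * s) ^+ 2 + (x * s + y * c) ^+ 2.
    by rewrite -xyr -[LHS]mulr1 -cs; ring.
  by rewrite lerDl sqr_ge0.
nra.
Qed.

(* A value m is attained by [fVW V W ^~ x] as soon as
   [V cos (x + a) + m W cos a = m - 1] has a solution, and it is the maximum
   when moreover the amplitude |V e^(ix) + m W| of the left-hand side is m - 1;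
   this is the larger root of the resulting quadratic equation in m. *)
Definition fmax_root V W x : R :=
  (1 + V * W * cos x + Num.sqrt ((V * cos x + W) ^+ 2
     + (1 - W ^+ 2) * (V * sin x) ^+ 2)) / (1 - W ^+ 2).

Section UnitIntervalBounds.
Variables V W : R.
Hypotheses (V01 : 0 <= V < 1) (W01 : 0 <= W < 1).

Let W2_gt0 : 0 < 1 - W ^+ 2.
Proof. by case/andP: W01 => W0 W1; rewrite subr_gt0 expr_lt1. Qed.

Lemma one_add_cos_gt0 t : 0 < 1 + V * cos t.
Proof. have /andP[? ?] := V01; have := cos_geN1 t; have := cos_le1 t; nra. Qed.

Lemma one_sub_cos_gt0 t : 0 < 1 - W * cos t.
Proof. have /andP[? ?] := W01; have := cos_geN1 t; have := cos_le1 t; nra. Qed.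

Lemma fmax_root_spec x : let m := fmax_root V W x in
  1 <= m /\ (V * cos x + m * W) ^+ 2 + (V * sin x) ^+ 2 = (m - 1) ^+ 2.
Proof.
move=> m; rewrite {}/m /fmax_root.
have cs := cos2Dsin2 x; set c := cos x in cs *; set s := sin x in cs *.
set D := (V * c + W) ^+ 2 + _.
have D0 : 0 <= D by rewrite addr_ge0 ?sqr_ge0 // mulr_ge0 ?sqr_ge0 // ltW.
have sD := sqr_sqrtr D0; set d := Num.sqrt D in sD *.
have d0 : 0 <= d by exact: sqrtr_ge0.
split; last first.
  have sE : s ^+ 2 = 1 - c ^+ 2 by rewrite -cs; ring.
  have dE : d ^+ 2 = (V * c + W) ^+ 2 + (1 - W ^+ 2) * V ^+ 2 * (1 - c ^+ 2).
    by rewrite sD /D -sE; ring.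
  set m := _ / _.
  (* Completing the square: multiplied by [1 - W ^+ 2], the amplitude equation becomes the square of
     this identity. *)
  have dm : d = m * (1 - W ^+ 2) - 1 - V * W * c.
    by rewrite /m divfK ?gt_eqF //; ring.
  rewrite dm in dE; apply: (@mulfI _ (1 - W ^+ 2)); first by rewrite gt_eqF.
  rewrite (exprMn _ V s) sE; apply/subr0_eq.
  by move/eqP: dE; rewrite -subr_eq0 => /eqP dE; rewrite -[RHS]oppr0 -dE; ring.
rewrite ler_pdivlMr // mul1r.
(* The goal [1 <= m] now amounts to [- (W * (V * c + W)) <= d]. *)
have : (W * (V * c + W)) ^+ 2 <= d ^+ 2.
  have -> : d ^+ 2 = (W * (V * c + W)) ^+ 2
      + (1 - W ^+ 2) * ((V * c + W) ^+ 2 + (V * s) ^+ 2) by rewrite sD /D; ring.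
  by rewrite lerDl mulr_ge0 ?(ltW W2_gt0) // addr_ge0 ?sqr_ge0.
rewrite -(ler_sqrt _ (sqr_ge0 d)) !sqrtr_sqr (ger0_norm d0) ler_norml => /andP[]; lra.
Qed.

Lemma fVW_le_root x t : fVW V W t x <= fmax_root V W x.
Proof.
have [m1 mE] := fmax_root_spec x; set m := fmax_root V W x in m1 mE *.
rewrite /fVW ler_pdivrMr ?one_sub_cos_gt0 //.
have := @cos_sin_cauchy _ _ _ t _ mE; rewrite subr_ge0 => /(_ m1).
rewrite cosD; lra.
Qed.

Lemma fVW_attains_root x : exists t, fVW V W t x = fmax_root V W x.
Proof.
have [m1 mE] := fmax_root_spec x; set m := fmax_root V W x in m1 mE *.
have m10 : 0 <= m - 1 by rewrite subr_ge0.
(* [t] is the opposite of a phase of [V e^(ix) + m W], which turns the bound of [cos_sin_cauchy]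
   into an equality. *)
have [|t [_ ct st]] := @exists_angle (V * cos x + m * W) (- (V * sin x)) (m - 1) m10.
  by rewrite sqrrN.
exists t; apply: (canLR (mulfK _)); first by rewrite gt_eqF // one_sub_cos_gt0.
have : (m - 1) * (cos t ^+ 2 + sin t ^+ 2)
    = (V * cos x + m * W) * cos t - (V * sin x) * sin t.
  by rewrite ct -[in RHS]mulNr st; ring.
rewrite cos2Dsin2 cosD; lra.
Qed.

Lemma fmaxE x : fmax V W x = fmax_root V W x.
Proof.
apply: is_max_maxval; split=> [|_ [t _ <-]]; last exact: fVW_le_root.
by have [t <-] := fVW_attains_root x; exists t.
Qed.

Lemma fmax_gt0 x : 0 < fmax V W x.
Proof.
rewrite fmaxE; exact: lt_le_trans ltr01 (proj1 (fmax_root_spec x)).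
Qed.

(** Continuity is read off the closed form [fmax_root]; the denominator stays positive because
    [V < 1]. *)
Lemma continuous_HVW b : continuous (HVW V W ^~ b).
Proof.
have -> : HVW V W ^~ b = fun x => fmax_root V W x / (1 + V * cos (x + b)).
  by apply/funext => x; rewrite /HVW fmaxE.
move=> x.
have ccos : {for x, continuous (@cos R)} by exact: continuous_cos.
have csin : {for x, continuous (@sin R)} by exact: continuous_sin.
apply: cvgM.
  apply: cvgM; last exact: cvg_cst.
  apply: cvgD.
    by apply: cvgD; [exact: cvg_cst|apply: cvgM => //; exact: cvg_cst].
  apply: continuous_comp; last exact: sqrt_continuous.
  apply: cvgD.
    rewrite expr2; under [X in X @ _ --> _]eq_fun do rewrite expr2.
    by apply: cvgM; (apply: cvgD; [apply: cvgM|]; try exact: cvg_cst).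
  apply: cvgM; first exact: cvg_cst.
  rewrite expr2; under [X in X @ _ --> _]eq_fun do rewrite expr2.
  by apply: cvgM; apply: cvgM; try exact: cvg_cst.
apply: cvgV; first by rewrite gt_eqF ?one_add_cos_gt0.
apply: cvgD; first exact: cvg_cst.
apply: cvgM; first exact: cvg_cst.
apply: continuous_comp; last exact: continuous_cos.
by apply: cvgD; [exact: cvg_id|exact: cvg_cst].
Qed.

(** The closed form and the denominator involve [x] only through [cos x] and [sin x], so the extreme
    value theorem on one period covers the whole line. *)
Lemma HVW_period b x :
  exists2 y, y \in `[- pi, pi] & HVW V W x b = HVW V W y b.
Proof.
have [y yi [cxy sxy]] := exists_angle_period x.
by exists y => //; rewrite /HVW !fmaxE /fmax_root !cosD cxy sxy.
Qed.

Let piNpi : - pi <= pi :> R. Proof. have := pi_ge0 R; lra. Qed.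

(** Ensures that [Hmax] is a genuine maximum and not the default value of [maxval]. *)
Lemma Hmax_is_max b : is_max (range (HVW V W ^~ b)) (Hmax V W b).
Proof.
have cH : {within `[- pi, pi], continuous (HVW V W ^~ b)}.
  by apply: continuous_subspaceT; exact: continuous_HVW.
have [c _ cmax] := EVT_max piNpi cH.
suff Hm : is_max (range (HVW V W ^~ b)) (HVW V W c b).
  by rewrite /Hmax (is_max_maxval Hm).
split=> [|_ [x _ <-]]; first by exists c.
by have [y yi ->] := HVW_period b x; apply: cmax.
Qed.

Lemma Hmin_is_min b : is_min (range (HVW V W ^~ b)) (Hmin V W b).
Proof.
have cH : {within `[- pi, pi], continuous (HVW V W ^~ b)}.
  by apply: continuous_subspaceT; exact: continuous_HVW.
have [c _ cmin] := EVT_min piNpi cH.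
suff Hm : is_min (range (HVW V W ^~ b)) (HVW V W c b).
  by rewrite /Hmin (is_min_minval Hm).
split=> [|_ [x _ <-]]; first by exists c.
by have [y yi ->] := HVW_period b x; apply: cmin.
Qed.

End UnitIntervalBounds.
End Trigonometry.

(** * Second moments of a complex vector given in polar form *)

Section Moments.
Variable R : realType.

Lemma sum_mul_comb n (A B : R) (f x y : 'I_n -> R) :
  \sum_i f i * (A * x i + B * y i)
    = A * (\sum_i f i * x i) + B * (\sum_i f i * y i).
Proof. by rewrite !mulr_sumr -big_split; apply: eq_bigr => i _ /=; ring. Qed.

(** For the vector [z] with entries [rho k e^(i a k)]: it has unit norm, and the unconjugated sum of
    its squares is [K e^(2 i d)]. *)
Definition second_moments n (rho a : 'I_n -> R) (K d : R) : Prop :=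
  [/\ \sum_k rho k ^+ 2 = 1,
      \sum_k rho k ^+ 2 * cos (2 * a k) = K * cos (2 * d) &
      \sum_k rho k ^+ 2 * sin (2 * a k) = K * sin (2 * d)].

(** The product-to-sum formula makes each summand affine in [cos (2 * a k)] and [sin (2 * a k)], so
    the moments determine the sum. *)
Lemma second_moments_cos n (rho a : 'I_n -> R) K d t s :
  second_moments rho a K d ->
  \sum_k rho k * cos (a k + t) * (rho k * cos (a k + s))
    = (cos (t - s) + K * cos (t + s + 2 * d)) / 2.
Proof.
move=> [m0 mc ms].
transitivity (\sum_k rho k ^+ 2 * (cos (t - s) / 2 * 1 + 1 *
    (cos (t + s) / 2 * cos (2 * a k) + (- sin (t + s) / 2) * sin (2 * a k)))).
  apply: eq_bigr => k _; rewrite cos2x sin2x !cosD cosN sinN sinD.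
  have := cos2Dsin2 (a k); move: (cos (a k)) (sin (a k)) => c' s' cs.
  by rewrite [X in _ / 2 * X + _](esym cs); field.
rewrite !sum_mul_comb mc ms (eq_bigr (fun k => rho k ^+ 2)) ?m0.
  by rewrite (cosD (t + s)); field.
by move=> k _; rewrite mulr1.
Qed.

End Moments.

(** * The ellipse of products of unit vectors with two orthogonal vectors *)

Section Ellipse.
Variables (R : realType) (n : nat) (W : R) (x y : 'I_n -> R).
Hypotheses (W01 : 0 <= W < 1).
Hypotheses (xx : \sum_i x i * x i = (1 + W) / 2)
  (yy : \sum_i y i * y i = (1 - W) / 2) (xy : \sum_i x i * y i = 0).
Local Notation dot u v := (\sum_i u i * v i).

(** Up to the factor [(1 - W ^+ 2) / 2], this is the combination of the dual basis of [x], [y] in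
    their span with coefficients [c], [s]; the factor clears the denominators. *)
Let h c s i := (1 - W) * c * x i + (1 + W) * s * y i.

Let dotC (u v : 'I_n -> R) : dot u v = dot v u.
Proof. by apply: eq_bigr => i _; rewrite mulrC. Qed.

Let dot_hx c s : dot x (h c s) = (1 - W ^+ 2) / 2 * c.
Proof. by rewrite sum_mul_comb xx xy; field. Qed.

Let dot_hy c s : dot y (h c s) = (1 - W ^+ 2) / 2 * s.
Proof. by rewrite sum_mul_comb yy dotC xy; field. Qed.

Let dot_hh c s : dot (h c s) (h c s)
  = (1 - W ^+ 2) / 2 * ((1 - W) * c ^+ 2 + (1 + W) * s ^+ 2).
Proof. by rewrite sum_mul_comb -!(dotC _ (h c s)) dot_hx dot_hy; ring. Qed.

(** Bessel's inequality for the orthogonal pair [x], [y], obtained by expanding the squared norm of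
    [e u - h c s]. *)
Lemma ellipse_bound (u : 'I_n -> R) : dot u u = 1 ->
  (1 - W) * dot u x ^+ 2 + (1 + W) * dot u y ^+ 2 <= (1 - W ^+ 2) / 2.
Proof.
move=> uu; set c := dot u x; set s := dot u y; set N := _ + _.
have /andP[W0 W1] := W01.
have e0 : 0 < (1 - W ^+ 2) / 2 by rewrite divr_gt0 // subr_gt0 expr_lt1.
set e := (1 - W ^+ 2) / 2 in e0 *.
have uh : dot u (h c s) = N by rewrite sum_mul_comb -/c -/s /N; ring.
have := dot_hh c s; rewrite -/e -/N; move: (h c s) uh => g uh gg.
have : 0 <= \sum_i (e * u i + (-1) * g i) * (e * u i + (-1) * g i).
  by apply: sumr_ge0 => i _; rewrite -expr2 sqr_ge0.
rewrite sum_mul_comb -(dotC u) -(dotC g) !sum_mul_comb uu gg (dotC g) uh; nra.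
Qed.

(** Equality in Bessel's inequality holds on the span of [x] and [y], so the witness is [h c s]
    divided by its norm [q]. *)
Lemma ellipse_attained c s : c ^+ 2 + s ^+ 2 = 1 ->
  exists (u : 'I_n -> R) r, [/\ dot u u = 1, dot u x = r * c, dot u y = r * s
    & r ^+ 2 * ((1 - W) * c ^+ 2 + (1 + W) * s ^+ 2) = (1 - W ^+ 2) / 2].
Proof.
move=> cs; have /andP[W0 W1] := W01.
have e0 : 0 < (1 - W ^+ 2) / 2 by rewrite divr_gt0 // subr_gt0 expr_lt1.
have N0 : 0 < (1 - W) * c ^+ 2 + (1 + W) * s ^+ 2.
  have := sqr_ge0 c; have := sqr_ge0 s; nra.
have := dot_hx c s; have := dot_hy c s; have := dot_hh c s.
set e := (1 - W ^+ 2) / 2 in e0 *; set N := _ + _ in N0 *; move=> hh hy hx.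
have eN0 : 0 < e * N by rewrite mulr_gt0.
pose q := Num.sqrt (e * N).
have q0 : q != 0 by rewrite sqrtr_eq0 -ltNge.
have q2 : q ^+ 2 = e * N by rewrite sqr_sqrtr // ltW.
exists (fun i => q^-1 * h c s i), (q^-1 * e).
have dotq f : dot (fun i => q^-1 * h c s i) f = q^-1 * dot f (h c s).
  by rewrite mulr_sumr; apply: eq_bigr => i _; ring.
split; rewrite ?dotq /=.
- by rewrite hh -q2; field.
- by rewrite hx mulrA.
- by rewrite hy mulrA.
- by rewrite exprMn exprVn q2; field; rewrite !gt_eqF.
Qed.

End Ellipse.

(** * Closed form of the oscillating term and its extrema *)

Section OscillatingTerm.
Variables (R : realType) (n : nat) (v : 'cV[R[i]]_n) (w : 'rV[R[i]]_n).
Variables (alpha beta : 'I_n -> R) (omega V W d th : R).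
Hypotheses (V01 : 0 <= V < 1) (W01 : 0 <= W < 1).
Let rho k := Normc.normc (v k 0).
Let eta l := Normc.normc (w 0 l).
Hypotheses (mv : second_moments rho alpha V d).
Hypotheses (mw : second_moments eta beta W th).

(** [x] and [y] are the real and imaginary parts of [w] rotated by [- th], which aligns the ellipse
    with the axes. Writing [y] as a shifted cosine lets [second_moments_cos] apply to it too. *)
Let x l := eta l * cos (beta l - th).
Let y l := eta l * cos (beta l + (- (pi / 2) - th)).

Let xx : \sum_l x l * x l = (1 + W) / 2.
Proof.
rewrite (second_moments_cos _ _ mw) subrr cos0.
by rewrite (_ : - th - th + 2 * th = 0) ?cos0 ?mulr1 //; ring.
Qed.

Let yy : \sum_l y l * y l = (1 - W) / 2.
Proof.
rewrite (second_moments_cos _ _ mw) subrr cos0.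
rewrite (_ : _ + _ + 2 * th = - pi); last by field.
by rewrite cosN cospi mulrN1.
Qed.

Let xy : \sum_l x l * y l = 0.
Proof.
rewrite (second_moments_cos _ _ mw).
rewrite (_ : - th - _ = pi / 2); last by field.
rewrite (_ : _ + _ + 2 * th = - (pi / 2)); last by field.
by rewrite cosN cos_pihalf mulr0 addr0 mul0r.
Qed.

Let yE l : y l = eta l * sin (beta l - th).
Proof. by rewrite -cosBpihalf /y; congr (_ * cos _); ring. Qed.

(** The term [th] is included because the angles [psi] and [gamma - th] are measured from the major
    axis. *)
Let X t := 2 * (omega * t + d + th).

Lemma norm2_Theta_vec gamma t :
  norm2 (Theta_vec v alpha omega gamma t)
    = Num.sqrt ((1 + V * cos (X t + 2 * (gamma - th))) / 2).
Proof.
congr Num.sqrt; have := second_moments_cos (omega * t + gamma) (omega * t + gamma) mv.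
rewrite subrr cos0 (_ : _ + _ + 2 * d = X t + 2 * (gamma - th)) => [<-|].
  by apply: eq_bigr => k _; rewrite mxE -expr2 addrCA addrA.
by rewrite /X; ring.
Qed.

(** With [w] in its polar form, [Theta_mx] maps [u] to the real part of [e^(i omega t) v (w u)], and
    the hypotheses say [w u = r e^(i (th + psi))]. The image is thus [r] times [Theta_vec] at angle
    [th + psi]. *)
Lemma norm2_Theta_mx_mul t (u : 'cV[R]_n) r psi :
  \sum_l u l 0 * x l = r * cos psi -> \sum_l u l 0 * y l = r * sin psi ->
  norm2 (Theta_mx v w alpha beta omega t *m u)
    = Num.sqrt (r ^+ 2 * ((1 + V * cos (X t + 2 * psi)) / 2)).
Proof.
move=> ux uy; congr Num.sqrt.
have := second_moments_cos (omega * t + th + psi) (omega * t + th + psi) mv.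
rewrite subrr cos0 (_ : _ + _ + 2 * d = X t + 2 * psi) => [<-|]; last by rewrite /X; ring.
rewrite mulr_sumr; apply: eq_bigr => k _; rewrite -!expr2 -exprMn; congr (_ ^+ 2).
transitivity (\sum_l u l 0 * (rho k * cos (omega * t + th + alpha k) * x l
    + - (rho k * sin (omega * t + th + alpha k)) * y l)).
  rewrite mxE; apply: eq_bigr => l _; rewrite mxE yE /x -/(rho k) -/(eta l).
  rewrite (_ : _ + _ + _ = omega * t + th + alpha k + (beta l - th)); last by ring.
  by rewrite [in LHS]cosD; ring.
rewrite sum_mul_comb ux uy.
rewrite (_ : alpha k + _ = omega * t + th + alpha k + psi); last by ring.
by rewrite [in RHS]cosD; ring.
Qed.

Lemma spectral_norm_Theta_mx t :
  spectral_norm (Theta_mx v w alpha beta omega t)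
    = Num.sqrt ((1 - W ^+ 2) / 4 * fmax V W (X t)).
Proof.
apply: is_max_sup; have /andP[W0 W1] := W01; split.
  (* A maximizer [a] of [fVW] is twice an angle on the ellipse, so the extremal [u] is taken in
     direction [a / 2]. *)
  have [a fa] := fVW_attains_root V W01 (X t).
  have [u [r [uu ux uy rE]]] := ellipse_attained W01 xx yy xy (cos2Dsin2 (a / 2)).
  have aE : 2 * (a / 2) = a by field.
  exists (\col_l u l).
    rewrite /= /norm2 (eq_bigr (fun l => u l * u l)) ?uu ?sqrtr1 // => l _.
    by rewrite mxE.
  rewrite (@norm2_Theta_mx_mul t _ r (a / 2)) ?aE; first last.
  - by rewrite -uy; apply: eq_bigr => l _; rewrite mxE.
  - by rewrite -ux; apply: eq_bigr => l _; rewrite mxE.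
  congr Num.sqrt; rewrite fmaxE // -fa /fVW.
  have ca := one_sub_cos_gt0 W01 a.
  have rE' : r ^+ 2 * (1 - W * cos a) = (1 - W ^+ 2) / 2.
    rewrite -rE -{1}aE cos2x -[X in _ * (X - _)](cos2Dsin2 (a / 2)); ring.
  rewrite (_ : (1 - W ^+ 2) / 4 = r ^+ 2 * (1 - W * cos a) / 2).
    by field; rewrite gt_eqF.
  by rewrite rE'; field.
move=> _ [u u1 <-].
have uu : \sum_l u l 0 * u l 0 = 1.
  move: u1 => /= /(congr1 (fun z => z ^+ 2)).
  rewrite sqr_sqrtr ?expr1n; last by apply: sumr_ge0 => i _; rewrite sqr_ge0.
  by move=> <-; apply: eq_bigr => i _; rewrite expr2.
have := ellipse_bound W01 xx yy xy uu.
set c := (\sum_i _ * x i); set s := (\sum_i _ * y i) => cs_le.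
have [|psi [_ cE sE]] := @exists_angle _ c s (Num.sqrt (c ^+ 2 + s ^+ 2)) (sqrtr_ge0 _).
  by rewrite sqr_sqrtr // addr_ge0 ?sqr_ge0.
rewrite (norm2_Theta_mx_mul t cE sE); apply: ler_wsqrtr.
move: (Num.sqrt _) cE sE => r cE sE; rewrite cE sE in cs_le.
have := fVW_le_root V W01 (X t) (2 * psi); rewrite -fmaxE //.
rewrite /fVW ler_pdivrMr ?one_sub_cos_gt0 //.
have m0 := fmax_gt0 V W01 (X t); move: (fmax _ _ _) m0 => m m0 le_m.
(* This is [ellipse_bound] in polar coordinates; multiplied by [m], it combines with [le_m] to bound
   the squared norm. *)
have rE : r ^+ 2 * (1 - W * cos (2 * psi)) <= (1 - W ^+ 2) / 2.
  apply: le_trans cs_le; rewrite cos2x -[X in _ * (X - _)](cos2Dsin2 psi); lra.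
have := sqr_ge0 r; move: (r ^+ 2) rE => r2 rE r20; nra.
Qed.

Lemma OT_E gamma t : OT v w alpha beta omega gamma t
  = Num.sqrt ((1 - W ^+ 2) / 2 * HVW V W (X t) (2 * (gamma - th))).
Proof.
have /andP[W0 W1] := W01.
rewrite /OT spectral_norm_Theta_mx norm2_Theta_vec /HVW.
have Vc := one_add_cos_gt0 V01 (X t + 2 * (gamma - th)).
rewrite -sqrtrV ?divr_ge0 1?ltW // -sqrtrM.
  by congr Num.sqrt; field; rewrite gt_eqF.
by rewrite mulr_ge0 ?(ltW (fmax_gt0 V W01 _)) // divr_ge0 // subr_ge0 expr_le1 // ltW.
Qed.

Hypothesis omega_neq0 : omega != 0.

(** Turns extrema over the time [t] into extrema over the angle in [HVW]. *)
Let X_onto z : exists t, X t = z.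
Proof. by exists ((z / 2 - d - th) / omega); rewrite /X; field. Qed.

Lemma OT_is_max gamma : is_max (range (OT v w alpha beta omega gamma))
  (Gmax V W (gamma - th)).
Proof.
have /andP[W0 W1] := W01.
have W2 : 0 <= (1 - W ^+ 2) / 2 by rewrite divr_ge0 // subr_ge0 expr_le1 // ltW.
rewrite /Gmax.
have [[z _ <-] ub] := Hmax_is_max V01 W01 (2 * (gamma - th)).
split=> [|_ [t _ <-]].
  by have [t <-] := X_onto z; exists t; rewrite // OT_E.
by rewrite OT_E; apply/ler_wsqrtr/ler_wpM2l => //; apply: ub; exists (X t).
Qed.

Lemma OT_is_min gamma : is_min (range (OT v w alpha beta omega gamma))
  (Gmin V W (gamma - th)).
Proof.
have /andP[W0 W1] := W01.
have W2 : 0 <= (1 - W ^+ 2) / 2 by rewrite divr_ge0 // subr_ge0 expr_le1 // ltW.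
rewrite /Gmin.
have [[z _ <-] lb] := Hmin_is_min V01 W01 (2 * (gamma - th)).
split=> [|_ [t _ <-]].
  by have [t <-] := X_onto z; exists t; rewrite // OT_E.
by rewrite OT_E; apply/ler_wsqrtr/ler_wpM2l => //; apply: lb; exists (X t).
Qed.

End OscillatingTerm.

(** * Moments and normalization of complex vectors *)

Section ComplexVectors.
Variable R : realType.

Lemma normc_sqr (z : R[i]) : Normc.normc z ^+ 2 = complex.Re z ^+ 2 + complex.Im z ^+ 2.
Proof. by case: z => a b; rewrite sqr_sqrtr // addr_ge0 ?sqr_ge0. Qed.

Lemma normc_ge0 (z : R[i]) : 0 <= Normc.normc z.
Proof. by case: z => a b; exact: sqrtr_ge0. Qed.

Lemma sum_sqr_polar n (z : 'I_n -> R[i]) (a : 'I_n -> R) :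
  (forall k, polar_angle (z k) (a k)) ->
  \sum_k z k * z k = (\sum_k Normc.normc (z k) ^+ 2 * cos (2 * a k))
                     +i* (\sum_k Normc.normc (z k) ^+ 2 * sin (2 * a k)).
Proof.
move=> za; elim/big_rec3: _ => [//|k s1 s2 s3 _ ->].
rewrite {1 2}za cos2x sin2x; apply/eqP; rewrite eq_complex /=.
by apply/andP; split; apply/eqP; ring.
Qed.

Lemma second_moments_exists n (z : 'I_n -> R[i]) (a : 'I_n -> R) :
  (forall k, polar_angle (z k) (a k)) -> \sum_k Normc.normc (z k) ^+ 2 = 1 ->
  exists d, second_moments (fun k => Normc.normc (z k)) a
    (Normc.normc (\sum_k z k * z k)) d.
Proof.
move=> za z1; have := sum_sqr_polar za; set S := \sum_k z k * z k => SE.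
have [|t [_ ct st]] := @exists_angle _ (complex.Re S) (complex.Im S) _ (normc_ge0 S).
  by rewrite normc_sqr.
by exists (t / 2); split=> //; rewrite (_ : 2 * (t / 2) = t) -?ct -?st ?SE //; field.
Qed.

(** The shift [pi / 2 - d] turns the cosines into sines, and the squares of [rho k * sin (a k - d)]
    sum to [(1 - K) / 2]. If [K >= 1] they all vanish, so every entry is a real multiple of
    [e^(i d)]. *)
Lemma second_moments_lt1 n (z : 'I_n -> R[i]) (a : 'I_n -> R) K d :
  (forall k, polar_angle (z k) (a k)) ->
  second_moments (fun k => Normc.normc (z k)) a K d ->
  K < 1 \/ exists c, forall k, (z k)^* = c * z k.
Proof.
move=> za m; have := second_moments_cos (pi / 2 - d) (pi / 2 - d) m.
rewrite subrr cos0 (_ : _ + _ + 2 * d = pi); last by field.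
rewrite cospi mulrN1; have [K1|K1 sq0] := ltP K 1; first by left.
(* The factor is [e^(- 2 i d)]. *)
right; exists (cos (2 * d) +i* - sin (2 * d)) => k.
have sk0 : Normc.normc (z k) * sin (a k - d) = 0.
  apply/eqP; rewrite -sqrf_eq0 eq_le sqr_ge0 andbT.
  apply: (@le_trans _ _ ((1 - K) / 2)); last by lra.
  rewrite -sq0 (bigD1 k) //= (_ : a k + (_ - _) = a k - d + pi / 2); last by ring.
  rewrite cosDpihalf mulrN mulrNN -expr2 lerDl sumr_ge0 // => i _.
  by rewrite -expr2 sqr_ge0.
rewrite [in RHS]za [in LHS]za; move: (Normc.normc _) sk0 => r ru.
have : a k = a k - d + d by rewrite subrK.
move: (a k - d) ru => u ru ->.
apply/eqP; rewrite eq_complex /= cos2x sin2x cosD sinD.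
have rr := cos2Dsin2 d; set c := cos d in rr *; set s := sin d in rr *.
have -> : r * (cos u * c - sin u * s) = r * cos u * c by rewrite mulrBr !mulrA ru; ring.
have -> : r * (sin u * c + cos u * s) = r * cos u * s by rewrite mulrDr !mulrA ru; ring.
by apply/andP; split; apply/eqP; rewrite -[LHS]mulr1 -[X in _ * X = _]rr; ring.
Qed.

Lemma normc_realM (c : R) z : Normc.normc (c%:C * z) = `|c| * Normc.normc z.
Proof. by rewrite Normc.normcM /Normc.normc /= expr0n addr0 sqrtr_sqr. Qed.

Lemma cnorm2_eq0 m n (M : 'M[R[i]]_(m, n)) : cnorm2 M = 0 -> M = 0.
Proof.
move/eqP; rewrite sqrtr_eq0 => M0; apply/matrixP => i j; rewrite mxE.
apply/Normc.eq0_normc/eqP; rewrite -sqrf_eq0 eq_le sqr_ge0 andbT.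
apply: le_trans M0; rewrite (bigD1 i) //= (bigD1 j) //= -addrA lerDl.
rewrite addr_ge0 //; first by rewrite sumr_ge0 // => k _; rewrite sqr_ge0.
by rewrite sumr_ge0 // => k _; rewrite sumr_ge0 // => l _; rewrite sqr_ge0.
Qed.

Lemma cnorm2_sqr m n (M : 'M[R[i]]_(m, n)) :
  cnorm2 M ^+ 2 = \sum_i \sum_j Normc.normc (M i j) ^+ 2.
Proof.
rewrite sqr_sqrtr // sumr_ge0 // => i _.
by rewrite sumr_ge0 // => j _; rewrite sqr_ge0.
Qed.

Lemma cnorm2_cnormalize_sqr m n (M : 'M[R[i]]_(m, n)) : M != 0 ->
  cnorm2 (cnormalize M) ^+ 2 = 1.
Proof.
move=> M0; have c0 : cnorm2 M != 0 by apply: contra_neq M0; exact: cnorm2_eq0.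
transitivity ((cnorm2 M)^-1 ^+ 2 * cnorm2 M ^+ 2); last first.
  by rewrite -exprMn mulVf // expr1n.
rewrite !cnorm2_sqr mulr_sumr; apply: eq_bigr => i _.
rewrite mulr_sumr; apply: eq_bigr => j _.
by rewrite mxE normc_realM exprMn real_normK ?num_real.
Qed.

Lemma normalized_col n (x : 'cV[R[i]]_n) : x != 0 ->
  \sum_k Normc.normc (cnormalize x k 0) ^+ 2 = 1.
Proof.
move=> /cnorm2_cnormalize_sqr <-; rewrite cnorm2_sqr.
by apply: eq_bigr => k _; rewrite big_ord1.
Qed.

Lemma normalized_row n (x : 'rV[R[i]]_n) : x != 0 ->
  \sum_l Normc.normc (cnormalize x 0 l) ^+ 2 = 1.
Proof. by move=> /cnorm2_cnormalize_sqr <-; rewrite cnorm2_sqr big_ord1. Qed.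

End ComplexVectors.

(** * Singular values from eigenvectors of [M M^T] *)

Section SingularValues.
Variable R : realType.

Lemma norm2_sqr n (x : 'cV[R]_n) : norm2 x ^+ 2 = (x^T *m x) 0 0.
Proof.
rewrite sqr_sqrtr ?sumr_ge0 // => [|i _]; last exact: sqr_ge0.
by rewrite mxE; apply: eq_bigr => i _; rewrite mxE expr2.
Qed.

(** The right singular vector is [M^T a] divided by its norm, which is the square root of [r]. *)
Lemma singular_value_gram m n (M : 'M[R]_(m, n)) (a : 'cV_m) r :
  0 < r -> norm2 a = 1 -> M *m (M^T *m a) = r *: a ->
  singular_value M (Num.sqrt r).
Proof.
move=> r0 a1 Ma; have q0 : Num.sqrt r != 0 by rewrite sqrtr_eq0 -ltNge.
exists a, ((Num.sqrt r)^-1 *: (M^T *m a)); split=> //.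
- exact: sqrtr_ge0.
- apply/eqP; rewrite -(eqrXn2 (n := 2)) ?sqrtr_ge0 // norm2_sqr expr1n.
  rewrite -scalemxAr [(_ *: _)^T]linearZ /= -scalemxAl trmx_mul trmxK.
  rewrite -mulmxA Ma -scalemxAr !scalerA [X in X *: _](_ : _ = 1).
    by rewrite scale1r -norm2_sqr a1 expr1n.
  by rewrite -invfM -expr2 sqr_sqrtr ?mulVf ?gt_eqF ?ltW.
- by rewrite -scalemxAr Ma scalerA -{2}(sqr_sqrtr (ltW r0)) expr2 mulKf.
- by rewrite scalerA mulfV // scale1r.
Qed.

End SingularValues.

(** * The major axis of the ellipse as half the argument of [w w^T] *)

Section MajorAxis.
Variables (R : realType) (n : nat) (w : 'rV[R[i]]_n) (beta : 'I_n -> R).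
Hypothesis hbeta : forall l, polar_angle (w 0 l) (beta l).
Let M := re_im_rows w.
Let rho l := Normc.normc (w 0 l).
Hypothesis rho1 : \sum_l rho l ^+ 2 = 1.
(** [D + i E] equals [w w^T], and [M M^T] is half of the matrix with rows [(1 + D, E)] and
    [(E, 1 - D)]. *)
Let D := \sum_l rho l ^+ 2 * cos (2 * beta l).
Let E := \sum_l rho l ^+ 2 * sin (2 * beta l).

Let M0 l : M 0 l = rho l * cos (beta l).
Proof. by rewrite mxE /= hbeta. Qed.

Let M1 l : M 1 l = rho l * sin (beta l).
Proof. by rewrite mxE /= hbeta. Qed.

Let M00 : \sum_l M 0 l * M 0 l = (1 + D) / 2.
Proof.
rewrite -[X in (X + D) / _]rho1 -big_split mulr_suml; apply: eq_bigr => l _ /=.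
by rewrite M0 cos2x sin2cos2; field.
Qed.

Let M11 : \sum_l M 1 l * M 1 l = (1 - D) / 2.
Proof.
rewrite -[X in (X - D) / _]rho1 -sumrB mulr_suml; apply: eq_bigr => l _ /=.
by rewrite M1 cos2x cos2sin2; field.
Qed.

Let M01 : \sum_l M 0 l * M 1 l = E / 2.
Proof.
rewrite mulr_suml; apply: eq_bigr => l _ /=.
by rewrite M0 M1 sin2x; field.
Qed.

Let MTa (a : 'cV[R]_2) l : (M^T *m a) l 0 = a 0 0 * M 0 l + a 1 0 * M 1 l.
Proof.
rewrite mxE big_ord_recl big_ord1 ![M^T _ _]mxE.
by rewrite (_ : lift ord0 ord0 = 1) ?[M _ _ * a _ _]mulrC //;
  apply/val_inj.
Qed.

Let gram0 (a : 'cV[R]_2) :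
  (M *m (M^T *m a)) 0 0 = ((1 + D) * a 0 0 + E * a 1 0) / 2.
Proof.
rewrite mxE; under eq_bigr do rewrite MTa.
by rewrite sum_mul_comb M00 M01; field.
Qed.

Let gram1 (a : 'cV[R]_2) :
  (M *m (M^T *m a)) 1 0 = (E * a 0 0 + (1 - D) * a 1 0) / 2.
Proof.
rewrite mxE; under eq_bigr do rewrite MTa.
rewrite sum_mul_comb M11 (eq_bigr (fun l => M 0 l * M 1 l)) ?M01 => [|l _].
  by field.
by rewrite mulrC.
Qed.

(** The left singular vector [(cos theta, sin theta)] is an eigenvector of the traceless matrix
    [2 M M^T - 1] for [ev = 2 sigma ^+ 2 - 1], which forces [D + i E = ev e^(2 i theta)]. Maximality
    of [sigma] gives [ev >= 0], so [ev] is the modulus of [w w^T]. *)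
Lemma major_axis_moments sigma (a : 'cV[R]_2) theta :
  largest_singular_value M sigma -> left_singular_vector M sigma a ->
  polar_angle (a 0 0 +i* a 1 0) theta ->
  second_moments rho beta (Normc.normc ((w *m w^T) 0 0)) theta.
Proof.
move=> [_ max_sigma] [b [sigma0 a1 _ Mb Ma]] htheta.
have aa : a 0 0 ^+ 2 + a 1 0 ^+ 2 = 1.
  have := norm2_sqr a; rewrite a1 expr1n mxE big_ord_recl big_ord1 !mxE.
  by rewrite (_ : lift ord0 ord0 = 1) -?expr2 //; apply/val_inj.
have [ac as_] : a 0 0 = cos theta /\ a 1 0 = sin theta.
  by case: htheta; rewrite aa sqrtr1 !mul1r.
have MMa : M *m (M^T *m a) = sigma ^+ 2 *: a.
  by rewrite Ma -scalemxAr Mb scalerA expr2.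
have := gram1 a; have := gram0 a; rewrite MMa ![(_ *: a) _ _]mxE ac as_.
have cs := cos2Dsin2 theta; set c := cos theta in ac cs *; set s := sin theta in as_ cs *.
move=> e0 e1; pose ev := 2 * sigma ^+ 2 - 1.
have DE : D = ev * cos (2 * theta).
  rewrite cos2x -/c -/s -[LHS]mulr1 -[X in _ * X = _]cs.
  have -> : D * (c ^+ 2 + s ^+ 2) = c * ((1 + D) * c + E * s) - c ^+ 2
     - (s * (E * c + (1 - D) * s) - s ^+ 2) by ring.
  have -> : (1 + D) * c + E * s = 2 * (sigma ^+ 2 * c) by rewrite e0; field.
  have -> : E * c + (1 - D) * s = 2 * (sigma ^+ 2 * s) by rewrite e1; field.
  by rewrite /ev; ring.
have EE : E = ev * sin (2 * theta).
  rewrite sin2x -/c -/s -[LHS]mulr1 -[X in _ * X = _]cs.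
  have -> : E * (c ^+ 2 + s ^+ 2) = s * ((1 + D) * c + E * s)
     + c * (E * c + (1 - D) * s) - 2 * c * s by ring.
  have -> : (1 + D) * c + E * s = 2 * (sigma ^+ 2 * c) by rewrite e0; field.
  have -> : E * c + (1 - D) * s = 2 * (sigma ^+ 2 * s) by rewrite e1; field.
  by rewrite /ev; ring.
have ev0 : 0 <= ev.
  (* The direction orthogonal to a is the other left singular vector; its
     singular value, sqrt (1 - sigma ^ 2), is at most sigma. *)
  rewrite leNgt; apply/negP => ev0.
  have t0 : 0 < 1 - sigma ^+ 2 by rewrite /ev in ev0; lra.
  pose a' : 'cV[R]_2 := \col_i if i == 0 then - s else c.
  have a'0 : a' 0 0 = - s by rewrite mxE.
  have a'1 : a' 1 0 = c by rewrite mxE.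
  have a'n : norm2 a' = 1.
    apply/eqP; rewrite -(eqrXn2 (n := 2)) ?sqrtr_ge0 // norm2_sqr expr1n.
    rewrite mxE big_ord_recl big_ord1 ![a'^T _ _]mxE.
    rewrite (_ : lift ord0 ord0 = 1) ?a'0 ?a'1; last by apply/val_inj.
    by rewrite mulrNN -!expr2 addrC cs.
  have Ma' : M *m (M^T *m a') = (1 - sigma ^+ 2) *: a'.
    apply/matrixP => i j; rewrite [j]ord1 [in RHS]mxE.
    have [->|->] : i = 0 \/ i = 1.
      by case: i => [[|[|]]] // ?; [left|right]; apply/val_inj.
      by rewrite gram0 a'0 a'1; move: e1; lra.
    by rewrite gram1 a'0 a'1; move: e0; lra.
  have := max_sigma _ (singular_value_gram t0 a'n Ma').
  rewrite -(ler_sqr (sqrtr_ge0 _)) // sqr_sqrtr ?(ltW t0) //.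
  by rewrite /ev in ev0; lra.
suff -> : Normc.normc ((w *m w^T) 0 0) = ev by [].
rewrite mxE (eq_bigr (fun l => w 0 l * w 0 l)) => [|l _]; last by rewrite mxE.
rewrite (sum_sqr_polar hbeta) -/D -/E /= DE EE !exprMn -mulrDr cos2Dsin2 mulr1.
by rewrite sqrtr_sqr ger0_norm.
Qed.

End MajorAxis.

(** The normalizing factor is real and nonzero, so it commutes with conjugation and cancels. *)
Lemma conjc_cnormalize (R : realType) m n (M : 'M[R[i]]_(m, n)) c : M != 0 ->
  map_mx conjc (cnormalize M) = c *: cnormalize M -> map_mx conjc M = c *: M.
Proof.
move=> M0; rewrite map_mxZ /= oppr0 scalerA mulrC -scalerA.
apply: (@scalerI _ _ ((cnorm2 M)^-1)%:C).
by apply: contra_neq M0 => /complexI/eqP; rewrite invr_eq0 => /eqP; exact: cnorm2_eq0.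
Qed.

(** * Jordan chains, rows of the inverse, and conjugation *)

Section JordanBasis.
Variables (R : realType) (n : nat).
Implicit Types (A : 'M[R]_n) (V : 'M[R[i]]_n).

Lemma uniq_flatten_mem (T : eqType) (ss : seq (seq T)) c c' x :
  uniq (flatten ss) -> c \in ss -> c' \in ss -> x \in c -> x \in c' -> c = c'.
Proof.
elim: ss => //= c0 ss IH; rewrite cat_uniq => /and3P[_ /hasPn disj /IH{}IH].
have notin d : d \in ss -> x \in d -> x \notin c0.
  by move=> dss xd; apply/disj/flattenP; exists d.
rewrite !inE => /predU1P[->|css] /predU1P[->|c'ss] xc xc' //.
- by have := notin _ c'ss xc'; rewrite xc.
- by have := notin _ css xc; rewrite xc'.
- exact: IH.
Qed.

Lemma jordan_chain_eigenvector A V mu j s :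
  jordan_chain A V mu (j :: s) -> cmx A *m col j V = mu *: col j V.
Proof. by case/andP => /eqP. Qed.

Lemma conjc_neq (z : R[i]) : 0 < complex.Im z -> z^* != z.
Proof.
by case: z => a b /= b0; rewrite eq_complex /= eqxx /= -subr_eq0 -opprD oppr_eq0
  -mulr2n mulrn_eq0 /= gt_eqF.
Qed.

Lemma col_unitmx_neq0 V j : V \in unitmx -> col j V != 0.
Proof.
move=> Vu; apply/eqP => /(congr1 (mulmx (invmx V))).
rewrite colE mulmxA mulVmx // mul1mx mulmx0 => /matrixP /(_ j 0).
by rewrite !mxE eqxx => /eqP; rewrite oner_eq0.
Qed.

(** Multiplication by [V] turns the rows into rows of the identity matrix. *)
Lemma row_invmx_proportional V i k (c : R[i]) : V \in unitmx ->
  row i (invmx V) = c *: row k (invmx V) -> i = k.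
Proof.
move=> Vu /(congr1 (mulmx^~ V)); rewrite -row_mul -scalemxAl -row_mul mulVmx //.
move=> /matrixP /(_ 0 i); rewrite !mxE eqxx; case: (eqVneq k i) => // _.
by rewrite mulr0 => /eqP; rewrite oner_eq0.
Qed.

(** As [A] is real, the conjugate of [x] is an eigenvector for [lam^*]. Proportionality to [x] would
    give [c * lam = c * lam^*], hence [c = 0] and [x = 0]. *)
Lemma eigenvector_not_real A lam (x : 'cV[R[i]]_n) c :
  0 < complex.Im lam -> cmx A *m x = lam *: x -> x != 0 ->
  map_mx conjc x <> c *: x.
Proof.
move=> lam_im Ax x0 xc; move: (congr1 (map_mx conjc) Ax).
rewrite map_mxM map_mxZ xc.
have -> : map_mx conjc (cmx A) = cmx A by apply/matrixP => i j; rewrite !mxE conjc_real.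
rewrite -scalemxAr Ax.
move=> /eqP; rewrite !scalerA -subr_eq0 -scalerBl scaler_eq0 (negPf x0) orbF.
rewrite mulrC -mulrBl mulf_eq0 subr_eq0 eq_sym (negPf (conjc_neq lam_im)) /= => /eqP c0.
move/eqP: x0; apply; apply/matrixP => i j; move/matrixP: xc => /(_ i j).
by rewrite c0 !mxE mul0r => /eqP; rewrite conjc_eq0 => /eqP.
Qed.

End JordanBasis.

Theorem theorem23 (R : realType) (n : nat) (A : 'M[R]_n)
  (hA : single_complex A)
  (lam : R[i]) (hlam : rightmost A lam) (hlam_im : 0 < complex.Im lam)
  (V : 'M[R[i]]_n) (chains : seq (seq 'I_n)) (hV : jordan_basis A V chains)
  (j : 'I_n) (s : seq 'I_n) (hjs : longest_chain A V chains lam (j :: s))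
  (hconj : conjugate_chain A V chains lam j s)
  (y0 : 'cV[R]_n) (hy0 : row (last j s) (invmx V) *m cmx y0 != 0) :
  let omega := complex.Im lam in
  let v := cnormalize (col j V) in
  let w := cnormalize (row (last j s) (invmx V)) in
  let V1 := Normc.normc ((v^T *m v) 0 0) in
  let W1 := Normc.normc ((w *m w^T) 0 0) in
  forall (alpha beta : 'I_n -> R)
    (halpha : forall k, polar_angle (v k 0) (alpha k))
    (hbeta : forall l, polar_angle (w 0 l) (beta l))
    (gamma : R) (hgamma : polar_angle ((w *m cmx (normalize y0)) 0 0) gamma)
    (sigma : R) (a : 'cV[R]_2) (theta : R)
    (hsigma : largest_singular_value (re_im_rows w) sigma)
    (ha : left_singular_vector (re_im_rows w) sigma a)
    (htheta : polar_angle (a 0 0 +i* a 1 0) theta),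
  is_max (range (OT v w alpha beta omega gamma)) (Gmax V1 W1 (gamma - theta)) /\
  is_min (range (OT v w alpha beta omega gamma)) (Gmin V1 W1 (gamma - theta)).
Proof.
move=> omega v w V1 W1 alpha beta halpha hbeta gamma _ sigma a theta hsigma ha htheta.
have [Vu /perm_uniq uniq_chains _] := hV; rewrite enum_uniq in uniq_chains.
have [js_chains js_lam _] := hjs.
have Aj := jordan_chain_eigenvector js_lam.
have v0 : col j V != 0 by exact: col_unitmx_neq0.
have w0 : row (last j s) (invmx V) != 0.
  by apply: contraNneq hy0 => ->; rewrite mul0mx.
have v1 := normalized_col v0; have w1 := normalized_row w0.
have [d mv] := second_moments_exists halpha v1.
have V1E : V1 = Normc.normc (\sum_k v k 0 * v k 0).
  by congr Normc.normc; rewrite mxE; apply: eq_bigr => k _; rewrite mxE.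
rewrite -V1E in mv.
have mw := major_axis_moments hbeta w1 hsigma ha htheta.
have V01 : 0 <= V1 < 1.
  rewrite normc_ge0 /=; have [//|[c vc]] := second_moments_lt1 halpha mv.
  case: (eigenvector_not_real hlam_im Aj v0 (c := c)); apply: conjc_cnormalize => //.
  by apply/matrixP => k l; rewrite [l]ord1 mxE [RHS]mxE; exact: vc.
have W01 : 0 <= W1 < 1.
  (* Otherwise [w] is proportional to its conjugate, so two rows of the inverse coincide. The chains
     for [lam] and [lam^*] then share their last index and are equal, and their first column is an
     eigenvector for two distinct eigenvalues. *)
  rewrite normc_ge0 /=; have [//|[c wc]] := second_moments_lt1 hbeta mw.
  have [j' [s' [[js'_chains js'_lam _] _ conj_last]]] := hconj.
  have last_eq : last j' s' = last j s.
    apply: (@row_invmx_proportional _ _ V _ _ c) => //.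
    rewrite conj_last; apply: conjc_cnormalize => //.
    by apply/rowP => l; rewrite mxE [RHS]mxE; exact: wc.
  have chain_eq := uniq_flatten_mem uniq_chains js_chains js'_chains
    (mem_last j s); rewrite -last_eq in chain_eq.
  case: (chain_eq (mem_last j' s')) js'_lam => <- _ /jordan_chain_eigenvector.
  rewrite Aj => /eqP; rewrite -subr_eq0 -scalerBl scaler_eq0 (negPf v0) orbF.
  by rewrite subr_eq0 eq_sym (negPf (conjc_neq hlam_im)).
have omega0 : omega != 0 by rewrite gt_eqF.
by split;
  [exact: (OT_is_max V01 W01 mv mw omega0)|exact: (OT_is_min V01 W01 mv mw omega0)].
Qed.
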